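(* Let $A(\varepsilon)=[a_{i,j}(\varepsilon)]_{1\le i,j\le m}$ and $B(\varepsilon)=[b_{i,j}(\varepsilon)]_{1\le i,j\le m}$ be $m$-by-$m$ real symmetric matrices depending on a real parameter $\varepsilon>0$ ($\varepsilon$ small enough) such that, as $\varepsilon\to0$, $$a_{i,j}(\varepsilon)=\tilde a^{(0)}_{i,j}\,\varepsilon^{\ell_i+\ell_j}+o\left(\varepsilon^{\ell_i+\ell_j}\right)\quad\text{for all }1\le i,j\le m-1,$$ $$a_{m,j}(\varepsilon)=a_{j,m}(\varepsilon)=o\left(\frac{\varepsilon^{\ell_j}}{|\log(\varepsilon)|^{1/2}}\right)\quad\text{for all }1\le j\le m-1,$$ $$a_{m,m}(\varepsilon)=\frac{c}{|\log(\varepsilon)|}+o\left(\frac1{|\log(\varepsilon)|}\right),$$ $$b_{i,j}(\varepsilon)=\delta_{i,j}+o(1)\quad\text{for all }1\le i,j\le m,$$ where $\{\ell_j\}_{j=1}^m$ is a non-increasing sequence of integers with $\ell_m=0$ and $\ell_{m-1}>0$, $\tilde A_0=[\tilde a^{(0)}_{i,j}]_{1\le i,j\le m-1}$ is a real, symmetric and positive-definite matrix, and $c$ is a positive constant. For $\varepsilon$ small enough, let $\{\mu_j(\varepsilon)\}_{j=1}^m$ be the (real) eigenvalues of the problem $A(\varepsilon)\xi=\mu\,B(\varepsilon)\xi$, $\xi\in\mathbb R^m$, counted with multiplicities and arranged in non-decreasing order. Let $k_1>\dots>k_p=0$ be the distinct values taken by $\{\ell_j\}_{j=1}^m$ and $m_1,\dots,m_p$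 the corresponding multiplicities (so $m=m_1+\dots+m_p$, $m_p=1$, and $\ell_s=k_i$ for $m_1+\dots+m_{i-1}+1\le s\le m_1+\dots+m_i$). Let $(\tilde D_0,\tilde L_0)$ be the Gram-Schmidt pair associated with $\tilde A_0$. For each $1\le i\le p-1$, let $\tilde D_i^{(0)}$ and $\tilde L_i^{(0)}$ be the $m_i$-by-$m_i$ diagonal blocks of $\tilde D_0$ and $\tilde L_0$, respectively, with row and column indices ranging over $m_1+\dots+m_{i-1}+1,\dots,m_1+\dots+m_i$, let $\tilde Q_i^{(0)}=(\tilde L_i^{(0)})^T\tilde L_i^{(0)}$, and let $\{\tilde\mu^{(0)}_{i,j}\}_{j=1}^{m_i}$ be the eigenvalues of the problem $\tilde D_i^{(0)}\xi=\mu\,\tilde Q_i^{(0)}\xi$, $\xi\in\mathbb R^{m_i}$, counted with multiplicities and arranged in non-decreasing order. Then, as $\varepsilon\to0$, $$\mu_{m_1+\dots+m_{i-1}+j}(\varepsilon)=\tilde\mu^{(0)}_{i,j}\,\varepsilon^{2k_i}+o\left(\varepsilon^{2k_i}\right)\quad\text{for all }1\le i\le p-1\text{ and }1\le j\le m_i,$$ $$\mu_m(\varepsilon)=\frac{c}{|\log(\varepsilon)|}+o\left(\frac{1}{|\log(\varepsilon)|}\right).$$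
   Context: Gram-Schmidt pair: for a real, symmetric, positive-definite $n$-by-$n$ matrix $A$, there is a unique pair $(D,L)$ of real $n$-by-$n$ matrices such that $D$ is diagonal, $L$ is lower-triangular with all diagonal coefficients equal to $1$, and $D=L^TAL$; this pair is called the Gram-Schmidt pair associated with $A$. $\delta_{i,j}$ is the Kronecker symbol. *)

(* Defs.v *)
From HB Require Import structures.
From mathcomp Require Import all_boot all_order all_algebra.
From mathcomp Require Import all_classical all_reals all_analysis.

Set Implicit Arguments.
Unset Strict Implicit.
Unset Printing Implicit Defensive.

Import Order.TTheory GRing.Theory Num.Theory.
Import numFieldNormedType.Exports.
Local Open Scope classical_set_scope.
Local Open Scope ring_scope.

Definition symmetric_mx (R : realType) (n : nat) (A : 'M[R]_n) : Prop :=
  A^T = A.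

Definition posdef_mx (R : realType) (n : nat) (A : 'M[R]_n) : Prop :=
  symmetric_mx A /\
  forall xi : 'cV[R]_n, xi != 0 -> 0 < (xi^T *m A *m xi) 0 0.

(* [is_trig_mx] is lower-triangularity: entries with row < column vanish. *)
Definition gram_schmidt_pair (R : realType) (n : nat) (A D L : 'M[R]_n) : Prop :=
  [/\ is_diag_mx D, is_trig_mx L, forall i, L i i = 1 & D = L^T *m A *m L].

(* The space of the [xi] with [A xi = mu B xi].  MathComp kernels consist of
   row vectors, hence the transpose: the rows in the kernel are the [xi^T]. *)
Definition geigenspace (R : realType) (n : nat) (A B : 'M[R]_n) (mu : R) :
    'M[R]_n :=
  kermx (A - mu *: B)^T.

(* [mu 0, ..., mu (n-1)] lists the eigenvalues of the problem [A xi = mu B xi]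
   in non-decreasing order, each one repeated according to its multiplicity,
   the dimension of its eigenspace.  Since [mu] has [n] terms, this forces the
   problem to be diagonalizable over [R], as it always is for [A] symmetric and
   [B] symmetric positive-definite. *)
Definition ordered_geigenvalues (R : realType) (n : nat) (A B : 'M[R]_n)
    (mu : 'I_n -> R) : Prop :=
  (forall i j : 'I_n, (i <= j)%N -> mu i <= mu j) /\
  (forall x : R, #|[set j | mu j == x]%SET| = \rank (geigenspace A B x)).

(* The embedding of indices [{0, ..., n-1}] into [{0, ..., n}]. *)
Definition wid (n : nat) (i : 'I_n) : 'I_n.+1 := widen_ord (leqnSn n) i.

(* [ms 0 + ... + ms (i-1)], the index at which the [i]-th block starts. *)
Definition block_start (p : nat) (ms : 'I_p -> nat) (i : 'I_p) : nat :=
  (\sum_(i' < p | (i' < i)%N) ms i')%N.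

(* The [j]-th index of the [i]-th block, as an element of [{0, ..., n}].
   [inord] sends numbers larger than [n] to [0]; this is only meant for blocks
   contained in [{0, ..., n}]. *)
Definition block_index (p n : nat) (ms : 'I_p -> nat) (i : 'I_p)
    (j : 'I_(ms i)) : 'I_n.+1 :=
  inord (block_start ms i + j).

Definition diag_block (R : realType) (p n : nat) (ms : 'I_p -> nat)
    (M : 'M[R]_n.+1) (i : 'I_p) : 'M[R]_(ms i) :=
  mxsub (@block_index p n ms i) (@block_index p n ms i) M.

(* Main.v *)
Require Import Defs.
From HB Require Import structures.
From mathcomp Require Import all_boot all_order all_algebra.
From mathcomp Require Import all_classical all_reals all_analysis.
From mathcomp Require Import ring lra.

Set Implicit Arguments.
Unset Strict Implicit.
Unset Printing Implicit Defensive.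

Import Order.TTheory GRing.Theory Num.Theory.
Import numFieldNormedType.Exports.
Local Open Scope classical_set_scope.
Local Open Scope ring_scope.

(** Why the theorem holds.  Put [s_i = eps ^ l_i] for [i < m] and
    [s_m = |log eps| ^ (-1/2)], and let [S] be the diagonal matrix of the [s_i].
    The four hypotheses on [A] then become one: [S^-1 A S^-1] converges to the
    positive-definite matrix [G] with diagonal blocks [A0] and [c].  Moreover
    [s_i / s_j] tends to [0] whenever [l_j < l_i], and [s_i = s_j] whenever
    [l_i = l_j].

    Let [(D, L)] be the Gram-Schmidt pair of [G]; it extends the pair of [A0] by
    the entries [c] and [1].  Since [L] is lower triangular and the [s_i] grow
    with [i], the entries [L_ij s_j / s_i] of [S^-1 L S] stay bounded, and this
    matrix converges to the block-diagonal part [Lm] of [L].  In each block let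
    [V_b] be an eigenbasis of the pencil [(D_b, L_b^T L_b)], normalized by
    [V_b^T L_b^T L_b V_b = 1], and let [X] be the block-diagonal matrix of the
    [V_b].  As [S] is scalar on each block, it commutes with [X], and the change
    of variables [P^T = S^-1 L S X] gives

      [P A P^T = S (L X)^T (S^-1 A S^-1) (L X) S = S (Lambda + o(1)) S],
      [P B P^T = (Lm X)^T (Lm X) + o(1) = 1 + o(1)],

    where [Lambda] is the diagonal matrix of the block eigenvalues.  Hence for
    each [d > 0] and [eps] small enough, the two quadratic forms are within
    factors [1 - d] and [1 + d] of those of [S Lambda S] and [1], and the
    Courant-Fischer principle puts the [j]-th eigenvalue within
    [(1 - d) / (1 + d)] and [(1 + d) / (1 - d)] of [lambda_j s_j ^ 2]; these
    numbers are in non-decreasing order for small [eps] because different blocks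
    have different orders of magnitude.

    The Courant-Fischer argument is [eigen_compare]; the existence of normalized
    eigenbases, deduced from the multiplicities, is [geigenbasis]; the
    asymptotic change of variables is [graded_eigenvalues]; the assembly of the
    blocks is [block_eigenvalues]. *)

(** * Quadratic forms and eigenbases of symmetric pencils *)

(** Vectors are rows throughout, as in row spaces; a change of variables is
    then [z *m P], and it turns [A] into [P *m A *m P^T]. *)
Definition qf (R : realType) (N : nat) (A : 'M[R]_N) (z : 'rV[R]_N) : R :=
  (z *m A *m z^T) 0 0.

Lemma qfE (R : realType) (N : nat) (A : 'M[R]_N) (z : 'rV[R]_N) :
  qf A z = \sum_i \sum_j z 0 i * A i j * z 0 j.
Proof.
rewrite /qf mxE exchange_big /=; apply: eq_bigr => j _.
by rewrite mxE mulr_suml; apply: eq_bigr => i _; rewrite mxE.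
Qed.

Lemma qf_diag (R : realType) (N : nat) (d : 'rV[R]_N) (z : 'rV[R]_N) :
  qf (diag_mx d) z = \sum_i d 0 i * z 0 i ^+ 2.
Proof.
rewrite qfE; apply: eq_bigr => i _; rewrite (bigD1 i) //= big1 ?addr0.
  by rewrite mxE eqxx mulr1n expr2; ring.
by move=> j /negPf ji; rewrite mxE eq_sym ji mulr0n mulr0 mul0r.
Qed.

Lemma qf1 (R : realType) (N : nat) (z : 'rV[R]_N) :
  qf 1%:M z = \sum_i z 0 i ^+ 2.
Proof.
rewrite -diag_const_mx qf_diag; apply: eq_bigr => i _.
by rewrite mxE mul1r.
Qed.

Lemma qfM (R : realType) (N : nat) (A P : 'M[R]_N) (z : 'rV[R]_N) :
  qf A (z *m P) = qf (P *m A *m P^T) z.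
Proof. by rewrite /qf trmx_mul !mulmxA. Qed.

Lemma sum_sqr_gt0 (R : realType) (N : nat) (z : 'rV[R]_N) :
  z != 0 -> 0 < \sum_i z 0 i ^+ 2.
Proof.
move=> z0; rewrite lt_def sumr_ge0 ?andbT; last by move=> i _; exact: sqr_ge0.
apply: contra z0 => /eqP /psumr_eq0P zz; apply/eqP/rowP => i.
by rewrite mxE; apply/eqP; rewrite -sqrf_eq0 zz // => j _; exact: sqr_ge0.
Qed.

Definition posqf (R : realType) (N : nat) (B : 'M[R]_N) :=
  forall z : 'rV[R]_N, z != 0 -> 0 < qf B z.

(** Gram-Schmidt orthonormalization inside a row space: a vector of [M] outside
    the span of the family built so far is made orthogonal to it, then
    normalized. *)
Lemma orthonormal_rows (R : realType) (N r : nat) (B : 'M[R]_N)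
    (M : 'M[R]_(r, N)) :
  B^T = B -> posqf B ->
  forall k : nat, (k <= \rank M)%N ->
  exists2 W : 'M[R]_(k, N), (W <= M)%MS & W *m B *m W^T = 1%:M.
Proof.
move=> Bs Bp; elim=> [|k IH] kM.
  exists 0; first exact: sub0mx.
  by rewrite mul0mx mul0mx; apply/matrixP => -[].
have [W WM WB] := IH (ltnW kM).
have /row_subPn[i nu] : ~~ (M <= W)%MS.
  apply/negP => /mxrankS MW.
  by have := leq_trans kM (leq_trans MW (rank_leq_row W)); rewrite ltnn.
set u := row i M in nu.
pose v := u - u *m B *m W^T *m W.
have v0 : v != 0.
  apply: contra nu; rewrite subr_eq0 => /eqP ->; exact: submxMl.
have vW : v *m B *m W^T = 0.
  rewrite !mulmxBl -[_ *m W *m B]mulmxA -[_ *m (W *m B) *m _]mulmxA WB mulmx1.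
  by rewrite subrr.
have Wv : W *m B *m v^T = 0.
  by apply: trmx_inj; rewrite !trmx_mul trmxK Bs trmx0 mulmxA.
have vM : (v <= M)%MS.
  by rewrite addmx_sub ?row_sub // eqmx_opp (submx_trans (submxMl _ _)).
have := Bp _ v0; rewrite /qf => vp.
pose a := (Num.sqrt ((v *m B *m v^T) 0 0))^-1.
(* The block form [1 + k] of [k.+1] lets [col_mx] prepend the new row. *)
change (exists2 W : 'M[R]_(1 + k, N), (W <= M)%MS & W *m B *m W^T = 1%:M).
exists (col_mx (a *: v) W).
  by rewrite col_mx_sub WM scalemx_sub.
rewrite tr_col_mx mul_col_mx mul_col_row WB linearZ /=.
rewrite -!(scalemxAl, scalemxAr) vW Wv !scaler0.
rewrite (@scalar_mx_block _ 1 k 1); congr block_mx.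
rewrite [v *m B *m v^T]mx11_scalar scalerA scale_scalar_mx; congr (_%:M).
rewrite /a -invfM -expr2 sqr_sqrtr ?ltW // mulVf ?gt_eqF //.
Qed.

(** The same family, indexed by [nat] so that families taken from eigenspaces of
    different dimensions have the same type. *)
Lemma orthonormal_family (R : realType) (N r : nat) (B : 'M[R]_N)
    (M : 'M[R]_(r, N)) :
  B^T = B -> posqf B ->
  exists f : nat -> 'rV[R]_N,
    forall i, (i < \rank M)%N -> (f i <= M)%MS /\
    forall j, (j < \rank M)%N -> f i *m B *m (f j)^T = (i == j)%:R%:M.
Proof.
move=> Bs Bp; have [W WM WB] := orthonormal_rows Bs Bp (leqnn (\rank M)).
exists (fun i => if insub i is Some i' then row i' W else 0) => i iM.
rewrite insubT /=; split; first exact: submx_trans (row_sub _ _) WM.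
move=> j jM; rewrite insubT /=.
have /matrixP/(_ (Ordinal iM) (Ordinal jM)) := WB.
rewrite [RHS]mxE -val_eqE /= => <-; apply/matrixP => x y.
rewrite !ord1 -row_mul tr_row [LHS]mxE [RHS]mxE mulr1n [RHS]mxE.
by apply: eq_bigr => q _; rewrite !mxE.
Qed.

(** Eigenspaces of different eigenvalues are orthogonal for [B], so orthonormal
    bases of the eigenspaces can be put together.  The row listed at [j] is the
    one whose rank in the basis of the eigenspace of [mu j] is the rank of [j]
    among the indices with the same value of [mu]; the count of these indices is
    the dimension of the eigenspace, which makes the basis complete. *)
Lemma geigenbasis (R : realType) (N : nat) (A B : 'M[R]_N) (mu : 'I_N -> R) :
  A^T = A -> B^T = B -> posqf B -> ordered_geigenvalues A B mu ->
  exists2 V : 'M[R]_N, V *m B *m V^T = 1%:M &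
    V *m A *m V^T = diag_mx (\row_j mu j).
Proof.
move=> As Bs Bp [_ mul].
have /choice[f fP] := fun x => orthonormal_family (Defs.geigenspace A B x) Bs Bp.
pose J x : {set 'I_N} := [set j | mu j == x]%SET.
pose ix j := index j (enum (J (mu j))).
pose v j := f (mu j) (ix j).
have jJ j : j \in enum (J (mu j)) by rewrite mem_enum inE.
have ixlt j : (ix j < \rank (Defs.geigenspace A B (mu j)))%N.
  by rewrite -mul cardE index_mem.
have vA j : v j *m A = mu j *: (v j *m B).
  have [/sub_kermxP + _] := fP (mu j) (ix j) (ixlt j).
  rewrite linearB /= linearZ /= As Bs mulmxBr -scalemxAr => /eqP.
  by rewrite subr_eq0 => /eqP.
have Av j : A *m (v j)^T = mu j *: (B *m (v j)^T).
  by apply: trmx_inj; rewrite trmx_mul linearZ /= trmx_mul trmxK As Bs.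
have vB i j : (v i *m B *m (v j)^T) = (i == j)%:R%:M.
  have [ij|ij] := eqVneq (mu i) (mu j).
    rewrite /v ij; have ixi := ixlt i; rewrite ij in ixi.
    have [_ /(_ _ (ixlt j)) ->] := fP (mu j) (ix i) ixi.
    congr (_%:R%:M); congr nat_of_bool.
    apply/eqP/eqP => [|-> //]; rewrite /ix ij => e.
    by rewrite -(nth_index i (jJ j)) -e nth_index // -ij.
  have -> : (i == j) = false by apply: contra_neqF ij => /eqP ->.
  rewrite raddf0.
  have : (mu i - mu j) *: (v i *m B *m (v j)^T) = 0.
    rewrite scalerBl [X in X - _](_ : _ = v i *m A *m (v j)^T).
      by rewrite -mulmxA Av -scalemxAr mulmxA subrr.
    by rewrite vA -scalemxAl.
  by move/eqP; rewrite scaler_eq0 subr_eq0 (negPf ij) => /eqP.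
have vrow (C : 'M[R]_N) i j :
    ((\matrix_(i, j) v i 0 j) *m C *m (\matrix_(i, j) v i 0 j)^T) i j
    = (v i *m C *m (v j)^T) 0 0.
  rewrite !mxE; apply: eq_bigr => q _; rewrite !mxE; congr (_ * _).
  by apply: eq_bigr => q' _; rewrite !mxE.
exists (\matrix_(i, j) v i 0 j); apply/matrixP => i j; rewrite vrow.
  by rewrite vB !mxE eqxx.
by rewrite vA -scalemxAl vB !mxE eqxx /= mulr1n mulr_natr.
Qed.

(** * Comparison of eigenvalues *)

(** The dimension count of the Courant-Fischer principle: the first [j + 1] rows
    of [V] and the last [N - j] rows of [P] span subspaces whose dimensions add
    up to [N + 1]. *)
Lemma common_vector (R : realType) (N : nat) (V P : 'M[R]_N) (j : 'I_N) :
  row_free V -> row_free P ->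
  exists y z : 'rV[R]_N, [/\ y *m V = z *m P, y *m V != 0,
    forall t : 'I_N, (j < t)%N -> y 0 t = 0 &
    forall t : 'I_N, (t < j)%N -> z 0 t = 0].
Proof.
move=> Vf Pf.
set U1 := (pid_mx j.+1 : 'M[R]_N) *m V; set U2 := copid_mx j *m P.
have /rowV0Pn[w] : (U1 :&: U2)%MS != 0.
  rewrite -mxrank_eq0; apply/negP => /eqP cap0.
  have := mxrank_sum_cap U1 U2; rewrite cap0 !mxrankMfree //.
  rewrite rank_pid_mx // rank_copid_mx ?(ltnW (ltn_ord j)) // addn0 => e.
  have := rank_leq_row (U1 + U2)%MS.
  by rewrite e addSn subnKC ?ltnn // ltnW.
rewrite sub_capmx => /andP[/submxP[D1 wE1] /submxP[D2 wE2]] w0.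
exists (D1 *m pid_mx j.+1), (D2 *m copid_mx j); rewrite -!mulmxA -/U1 -/U2.
split; rewrite -?wE1 // => t jt; rewrite mxE big1 // => q _; rewrite !mxE.
  by case: eqVneq => [->|_]; rewrite /= ?[(_ < j.+1)%N]ltnNge ?jt ?mulr0.
have [->|ne] := eqVneq q t; first by rewrite eqxx jt subrr mulr0.
by rewrite (negPf ne : (val q == val t) = false) subr0 mulr0.
Qed.

(** Courant-Fischer in a two-sided multiplicative form.  A vector that is common
    to the first [j + 1] eigenvectors and to the last rows of [P] has a Rayleigh
    quotient at most [mu j] and at least [(1 - d) / (1 + d) * lam j]; exchanging
    first and last gives the other inequality. *)
Lemma eigen_compare (R : realType) (N : nat) (A B V P : 'M[R]_N)
    (mu lam : 'I_N -> R) (d : R) :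
  0 < d < 1 ->
  V *m B *m V^T = 1%:M -> V *m A *m V^T = diag_mx (\row_j mu j) ->
  (forall i j : 'I_N, (i <= j)%N -> mu i <= mu j) ->
  (forall i j : 'I_N, (i <= j)%N -> lam i <= lam j) ->
  (forall i, 0 < lam i) ->
  (forall z : 'rV[R]_N, (1 - d) * \sum_i lam i * z 0 i ^+ 2 <= qf A (z *m P)
             <= (1 + d) * \sum_i lam i * z 0 i ^+ 2) ->
  (forall z : 'rV[R]_N, (1 - d) * \sum_i z 0 i ^+ 2 <= qf B (z *m P)
             <= (1 + d) * \sum_i z 0 i ^+ 2) ->
  forall j, (1 - d) * lam j <= (1 + d) * mu j /\
            (1 - d) * mu j <= (1 + d) * lam j.
Proof.
move=> /andP[d0 d1] VB VA muS lamS lam0 hA hB j.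
have Vf : row_free V.
  by rewrite row_free_unit; apply: (mulmx1_unit (B := B *m V^T) _).1; rewrite mulmxA.
have Pf : row_free P.
  apply/row_freeP; exists (pinvmx P); apply/mulmxVp/inj_row_free => z zP.
  apply/eqP; apply: contraT => /sum_sqr_gt0 z0.
  have /andP[+ _] := hB z; rewrite zP /qf !mul0mx mxE.
  by rewrite pmulr_rle0 ?subr_gt0 // leNgt z0.
have qB y : qf B (y *m V) = \sum_i y 0 i ^+ 2 by rewrite qfM VB qf1.
have qA y : qf A (y *m V) = \sum_i mu i * y 0 i ^+ 2.
  by rewrite qfM VA qf_diag; apply: eq_bigr => i _; rewrite mxE.
have up (f : 'I_N -> R) (y : 'rV[R]_N) :
    (forall i j : 'I_N, (i <= j)%N -> f i <= f j) ->
    (forall t : 'I_N, (j < t)%N -> y 0 t = 0) ->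
    \sum_i f i * y 0 i ^+ 2 <= f j * \sum_i y 0 i ^+ 2.
  move=> fS y0; rewrite mulr_sumr; apply: ler_sum => i _.
  have [/y0 ->|ij] := ltnP j i; first by rewrite expr0n !mulr0.
  by rewrite ler_wpM2r ?sqr_ge0 ?fS.
have dn (f : 'I_N -> R) (y : 'rV[R]_N) :
    (forall i j : 'I_N, (i <= j)%N -> f i <= f j) ->
    (forall t : 'I_N, (t < j)%N -> y 0 t = 0) ->
    f j * \sum_i y 0 i ^+ 2 <= \sum_i f i * y 0 i ^+ 2.
  move=> fS y0; rewrite mulr_sumr; apply: ler_sum => i _.
  have [/y0 ->|ij] := ltnP i j; first by rewrite expr0n !mulr0.
  by rewrite ler_wpM2r ?sqr_ge0 ?fS.
have pos (y z : 'rV[R]_N) : y *m V = z *m P -> y *m V != 0 ->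
    0 < \sum_i y 0 i ^+ 2 /\ 0 < \sum_i z 0 i ^+ 2.
  move=> yz w0; split; apply: sum_sqr_gt0.
    by apply: contra w0 => /eqP ->; rewrite mul0mx.
  by apply: contra w0 => /eqP e; rewrite yz e mul0mx.
split.
  have [y [z [yz w0 ysup zsup]]] := common_vector j Vf Pf.
  have [Y0 Z0] := pos _ _ yz w0.
  have /andP[A1 _] := hA z; have /andP[_ B2] := hB z.
  move: A1 B2; rewrite -yz qB qA => A1 B2.
  have h1 := up _ _ muS ysup; have h2 := dn _ _ lamS zsup.
  have h3 : (1 - d) * (lam j * \sum_i z 0 i ^+ 2) <= mu j * \sum_i y 0 i ^+ 2.
    by apply: le_trans h1; apply: le_trans A1; rewrite ler_wpM2l // subr_ge0 ltW.
  have mu0 : 0 < mu j.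
    rewrite -(pmulr_lgt0 _ Y0); apply: lt_le_trans h3.
    by rewrite mulr_gt0 ?subr_gt0 // mulr_gt0.
  rewrite -(ler_pM2r Z0) -mulrA (le_trans h3) //.
  by rewrite [(1 + d) * _]mulrC -mulrA ler_pM2l.
have [z [y [yz w0 zsup ysup]]] := common_vector j Pf Vf.
have w0' : y *m V != 0 by rewrite -yz.
have [Y0 Z0] := pos _ _ (esym yz) w0'.
have /andP[_ A2] := hA z; have /andP[B1 _] := hB z.
move: A2 B1; rewrite yz qB qA => A2 B1.
have h1 := dn _ _ muS ysup; have h2 := up _ _ lamS zsup.
have [mu0|mu0] := leP (mu j) 0.
  apply: (@le_trans _ _ 0).
    by rewrite pmulr_rle0 ?subr_gt0.
  by rewrite mulr_ge0 ?ltW // addr_gt0 // ltr01.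
rewrite -(ler_pM2r Z0) -[leRHS]mulrA.
apply: (@le_trans _ _ (mu j * \sum_i y 0 i ^+ 2)).
  by rewrite [(1 - d) * _]mulrC -mulrA ler_pM2l.
apply: (le_trans h1); apply: (le_trans A2); rewrite ler_wpM2l //.
by rewrite ltW // addr_gt0 // ltr01.
Qed.

(** * Entrywise convergence of matrices and of their quadratic forms *)

Definition mconv (T : Type) (F : set_system T) (R : realType) (m n : nat)
    (M : T -> 'M[R]_(m, n)) (M0 : 'M[R]_(m, n)) : Prop :=
  forall i j, M e i j @[e --> F] --> M0 i j.

Lemma mconv_mul (T : Type) (F : set_system T) (FF : Filter F) (R : realType)
    (m n p : nat) (M : T -> 'M[R]_(m, n)) (K : T -> 'M[R]_(n, p)) M0 K0 :
  mconv F M M0 -> mconv F K K0 ->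
  mconv F (fun e => M e *m K e) (M0 *m K0).
Proof.
move=> hM hK i j; rewrite mxE.
rewrite [X in X @ F --> _](_ : _ = fun e => \sum_q M e i q * K e q j); last first.
  by apply/funext => e; rewrite mxE.
apply: cvg_big; first exact: add_continuous.
by move=> q _; apply: cvgM; [exact: hM|exact: hK].
Qed.

Lemma mconv_cst (T : Type) (F : set_system T) (FF : Filter F) (R : realType)
    (m n : nat) (M0 : 'M[R]_(m, n)) : mconv F (fun=> M0) M0.
Proof. by move=> i j; exact: cvg_cst. Qed.

Lemma mconv_tr (T : Type) (F : set_system T) (R : realType)
    (m n : nat) (M : T -> 'M[R]_(m, n)) M0 :
  mconv F M M0 -> mconv F (fun e => (M e)^T) M0^T.
Proof.
move=> hM i j; rewrite mxE.
rewrite [X in X @ F --> _](_ : _ = fun e => M e j i); first exact: hM.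
by apply/funext => e; rewrite mxE.
Qed.

Lemma sum_pairs (R : realType) (N : nat) (f : 'I_N -> R) :
  \sum_i \sum_j (f i + f j) = 2 * N%:R * \sum_i f i.
Proof.
rewrite (eq_bigr (fun i => f i *+ N + \sum_j f j)); last first.
  by move=> i _; rewrite big_split /= sumr_const card_ord.
rewrite big_split /= sumr_const card_ord -sumrMnl -mulr_natl.
by under eq_bigr do rewrite -mulr_natl; rewrite -mulr_sumr; ring.
Qed.

(** A form close to a positive diagonal form is close to it in relative value:
    the terms of the difference are absorbed by [2 * |x * y| <= x ^ 2 + y ^ 2]. *)
Lemma near_diag (T : Type) (F : set_system T) (FF : Filter F) (R : realType)
    (N : nat) (M : T -> 'M[R]_N) (lam : 'I_N -> R) (d : R) :
  (forall i, 0 < lam i) -> 0 < d ->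
  mconv F M (diag_mx (\row_i lam i)) ->
  \forall e \near F, forall z : 'rV[R]_N,
    (1 - d) * \sum_i lam i * z 0 i ^+ 2 <= qf (M e) z
      <= (1 + d) * \sum_i lam i * z 0 i ^+ 2.
Proof.
case: N M lam => [|N] M lam lam0 d0 hM.
  by near=> e => z; rewrite qfE !big_ord0 !mulr0 lexx.
have N0R : 0 < N.+1%:R :> R by rewrite ltr0n.
(* With this tolerance, entry [(i, j)] contributes at most
   [d / (2 * N.+1) * (lam i * z_i ^ 2 + lam j * z_j ^ 2)]; these add up to the
   factor [d]. *)
pose tol i j := d / N.+1%:R * Num.min (lam i) (lam j).
have tol0 i j : 0 < tol i j by rewrite !mulr_gt0 ?invr_gt0 // lt_min !lam0.
have close : \forall e \near F, forall i j,
    `|M e i j - diag_mx (\row_i lam i) i j| <= tol i j.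
  apply: filter_forall => i; apply: filter_forall => j.
  by have /cvgrPdistC_le/(_ _ (tol0 i j)) := hM i j.
near=> e => z.
have close_e : forall i j, `|M e i j - diag_mx (\row_i lam i) i j| <= tol i j.
  by near: e; exact: close.
have diff : `|qf (M e) z - \sum_i lam i * z 0 i ^+ 2|
    <= d * \sum_i lam i * z 0 i ^+ 2.
  have -> : \sum_i lam i * z 0 i ^+ 2 = qf (diag_mx (\row_i lam i)) z.
    by rewrite qf_diag; apply: eq_bigr => i _; rewrite mxE.
  rewrite [in leRHS]qf_diag.
  under [in leRHS]eq_bigr do rewrite mxE.
  rewrite !qfE -sumrB; under [X in `|X|]eq_bigr do rewrite -sumrB.
  apply: le_trans (ler_norm_sum _ _ _) _.
  apply: (@le_trans _ _ (\sum_(i < N.+1) \sum_(j < N.+1)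
      d / N.+1%:R / 2 * (lam i * z 0 i ^+ 2 + lam j * z 0 j ^+ 2))).
    apply: ler_sum => i _; apply: le_trans (ler_norm_sum _ _ _) _.
    apply: ler_sum => j _.
    rewrite -mulrBl -mulrBr !normrM.
    set a := `|z 0 i|; set b := `|z 0 j|.
    have -> : z 0 i ^+ 2 = a ^+ 2 by rewrite real_normK ?num_real.
    have -> : z 0 j ^+ 2 = b ^+ 2 by rewrite real_normK ?num_real.
    have a0 : 0 <= a by exact: normr_ge0.
    have b0 : 0 <= b by exact: normr_ge0.
    apply: (@le_trans _ _ (a * tol i j * b)).
      by rewrite ler_wpM2r // ler_wpM2l.
    rewrite /tol; set q := d / N.+1%:R.
    have q0 : 0 < q by rewrite divr_gt0.
    set t := Num.min _ _.
    have t1 : t <= lam i by rewrite ge_min lexx.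
    have t2 : t <= lam j by rewrite ge_min lexx orbT.
    have t0 : 0 < t by rewrite lt_min !lam0.
    rewrite (_ : a * _ * b = q / 2 * (t * (2 * a * b))); last by field.
    rewrite ler_pM2l ?divr_gt0 //.
    apply: (@le_trans _ _ (t * (a ^+ 2 + b ^+ 2))).
      rewrite ler_pM2l // -subr_ge0 [leRHS](_ : _ = (a - b) ^+ 2) ?sqr_ge0 //.
      by ring.
    by rewrite mulrDr lerD // ler_wpM2r ?sqr_ge0.
  rewrite le_eqVlt; apply/orP; left; apply/eqP.
  rewrite (eq_bigr (fun i => d / N.+1%:R / 2 *
    \sum_j (lam i * z 0 i ^+ 2 + lam j * z 0 j ^+ 2))); last first.
    by move=> i _; rewrite mulr_sumr.
  rewrite -mulr_sumr (sum_pairs (fun i => lam i * z 0 i ^+ 2)).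
  by field; rewrite nat1r gt_eqF.
move: diff; rewrite ler_norml => /andP[l1 l2].
by apply/andP; split; lra.
Unshelve. all: by end_near. Qed.

(** * Pencils with several scales *)

(** The change of variables [Pt = S^-1 L S X] makes the rescaled pencil converge
    to the diagonal pencil of the [lam i] and [1], whatever the relative speeds
    of the scales [s]; only the limit [Lm] of [S^-1 L S] depends on them. *)
Lemma graded_eigenvalues (T : Type) (F : set_system T) (FF : Filter F)
    (R : realType) (N : nat) (A B : T -> 'M[R]_N) (G L Lm X : 'M[R]_N)
    (s mu : T -> 'I_N -> R) (lam : 'I_N -> R) (d : R) :
  let S e := diag_mx (\row_i s e i) in
  let Si e := diag_mx (\row_i (s e i)^-1) in
  (\forall e \near F, (A e)^T = A e) -> (\forall e \near F, (B e)^T = B e) ->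
  (\forall e \near F, forall i, 0 < s e i) ->
  mconv F (fun e => Si e *m A e *m Si e) G ->
  mconv F B 1%:M ->
  mconv F (fun e => Si e *m L *m S e) Lm ->
  (forall e i j, X i j != 0 -> s e i = s e j) ->
  (L *m X)^T *m G *m (L *m X) = diag_mx (\row_i lam i) ->
  (Lm *m X)^T *m (Lm *m X) = 1%:M ->
  (forall i, 0 < lam i) ->
  (\forall e \near F, forall i j : 'I_N, (i <= j)%N ->
     lam i * s e i ^+ 2 <= lam j * s e j ^+ 2) ->
  (\forall e \near F, ordered_geigenvalues (A e) (B e) (mu e)) ->
  0 < d < 1 ->
  \forall e \near F, forall j,
    (1 - d) * (lam j * s e j ^+ 2) <= (1 + d) * mu e j /\
    (1 - d) * mu e j <= (1 + d) * (lam j * s e j ^+ 2).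
Proof.
move=> S Si Asym Bsym spos hA hB hL hX GX QX lam0 srt hmu d01.
have /andP[d0 d1] := d01.
pose Pt e := Si e *m L *m S e *m X.
(* [S] is scalar on each block of [X]. *)
have SX e : S e *m X = X *m S e.
  apply/matrixP => i j; rewrite mul_diag_mx mul_mx_diag !mxE.
  by have [->|/hX->] := eqVneq (X i j) 0; rewrite ?mulr0 ?mul0r // mulrC.
have hM : mconv F (fun e => (L *m X)^T *m (Si e *m A e *m Si e) *m (L *m X))
    (diag_mx (\row_i lam i)).
  rewrite -GX; apply: mconv_mul; last exact: mconv_cst.
  by apply: mconv_mul; first exact: mconv_cst.
have hPt : mconv F Pt (Lm *m X) by apply: mconv_mul => //; exact: mconv_cst.
have one1 : 1%:M = diag_mx (\row_i (fun=> 1) i) :> 'M[R]_N.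
  by rewrite -diag_const_mx; congr diag_mx; apply/rowP => i; rewrite !mxE.
have hN : mconv F (fun e => (Pt e)^T *m B e *m Pt e) (diag_mx (\row_i (fun=> 1) i)).
  rewrite -one1 -QX -[(_ *m _)^T]mulmx1; apply: mconv_mul => //.
  by apply: mconv_mul => //; exact: mconv_tr.
(* [d = 1/2] already shows that [B] is positive definite for small parameters. *)
have half0 : 0 < 2^-1 :> R by rewrite invr_gt0.
have hB1 := hB; rewrite one1 in hB1.
have nB := near_diag FF (fun=> ltr01) half0 hB1.
have nM := near_diag FF lam0 d0 hM.
have nN := near_diag FF (fun=> ltr01) d0 hN.
near=> e.
have spos_e : forall i, 0 < s e i by near: e.
have As : (A e)^T = A e by near: e.
have Bs : (B e)^T = B e by near: e.
have Bp : posqf (B e).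
  have nBe : forall z : 'rV[R]_N, (1 - 2^-1) * \sum_i 1 * z 0 i ^+ 2 <= qf (B e) z
      <= (1 + 2^-1) * \sum_i 1 * z 0 i ^+ 2 by near: e.
  move=> z z0; have /andP[+ _] := nBe z; apply: lt_le_trans.
  rewrite mulr_gt0 ?subr_gt0 ?invf_lt1 ?ltr1n //.
  by under eq_bigr do rewrite mul1r; exact: sum_sqr_gt0.
have mu_e : ordered_geigenvalues (A e) (B e) (mu e) by near: e.
have [V VB VA] := geigenbasis As Bs Bp mu_e.
have [muS _] := mu_e.
apply: (eigen_compare (P := (Pt e)^T) (lam := fun i => lam i * s e i ^+ 2) d01 VB VA muS).
- by near: e.
- by move=> i; rewrite mulr_gt0 // exprn_gt0.
- move=> z; rewrite qfM trmxK.
  have nMe : forall z : 'rV[R]_N, (1 - d) * \sum_i lam i * z 0 i ^+ 2 <=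
     qf ((L *m X)^T *m (Si e *m A e *m Si e) *m (L *m X)) z
      <= (1 + d) * \sum_i lam i * z 0 i ^+ 2 by near: e.
  have := nMe (z *m S e); rewrite qfM.
  rewrite (eq_bigr (fun i => lam i * s e i ^+ 2 * z 0 i ^+ 2)); last first.
    by move=> i _; rewrite mul_mx_diag !mxE exprMn; ring.
  have -> : (Pt e)^T *m A e *m Pt e =
    S e *m ((L *m X)^T *m (Si e *m A e *m Si e) *m (L *m X)) *m (S e)^T; last by [].
  have -> : Pt e = Si e *m L *m X *m S e by rewrite /Pt -mulmxA SX mulmxA.
  by rewrite !trmx_mul !tr_diag_mx !mulmxA.
- move=> z; rewrite qfM trmxK.
  have nNe : forall z : 'rV[R]_N, (1 - d) * \sum_i 1 * z 0 i ^+ 2 <=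
     qf ((Pt e)^T *m B e *m Pt e) z
      <= (1 + d) * \sum_i 1 * z 0 i ^+ 2 by near: e.
  by have := nNe z; under eq_bigr do rewrite mul1r.
Unshelve. all: by end_near. Qed.

(** * The blocks of a non-increasing sequence *)

Lemma card_lt_ord (N m : nat) : (m <= N)%N ->
  #|[set j : 'I_N | (j < m)%N]%SET| = m.
Proof.
move=> mN; rewrite -sum1dep_card (big_ord_narrow mN) /=.
by rewrite sum_nat_const card_ord muln1.
Qed.

Lemma downset_lt_card (N : nat) (S : {set 'I_N}) :
  (forall i j : 'I_N, (i <= j)%N -> j \in S -> i \in S) ->
  forall i : 'I_N, (i \in S) = (i < #|S|)%N.
Proof.
move=> dS i; apply/idP/idP => [iS|].
  rewrite -[X in (X <= _)%N](card_lt_ord (ltn_ord i)); apply/subset_leq_card/fintype.subsetP => j.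
  by rewrite inE ltnS => ji; exact: dS iS.
apply: contraTT => iS; rewrite -leqNgt.
rewrite -[X in (_ <= X)%N](card_lt_ord (ltnW (ltn_ord i))).
apply/subset_leq_card/fintype.subsetP => j jS; rewrite inE ltnNge.
by apply: contra iS => /dS; apply.
Qed.

Definition block_decomposition (n : nat) (l : 'I_n.+1 -> int) (p : nat)
    (k : 'I_p -> int) (ms : 'I_p -> nat) : Prop :=
  [/\ forall s t : 'I_n.+1, (s <= t)%N -> l t <= l s,
      forall i j : 'I_p, (i < j)%N -> k j < k i,
      codom k =i codom l &
      forall i : 'I_p, ms i = #|[set s | l s == k i]%SET|].

Section blocks.
Variables (n : nat) (l : 'I_n.+1 -> int) (p : nat) (k : 'I_p -> int).
Variable ms : 'I_p -> nat.
Hypothesis blk : block_decomposition l k ms.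

Let l_noninc (s t : 'I_n.+1) : (s <= t)%N -> l t <= l s.
Proof. by case: blk => + _ _ _; apply. Qed.

Let k_decr (i j : 'I_p) : (i < j)%N -> k j < k i.
Proof. by case: blk => _ + _ _; apply. Qed.

Let k_values : codom k =i codom l.
Proof. by case: blk. Qed.

Let ms_mult (i : 'I_p) : ms i = #|[set s | l s == k i]%SET|.
Proof. by case: blk. Qed.

Lemma k_lt (i j : 'I_p) : (k j < k i) = (i < j)%N.
Proof.
have [/k_decr//|ji|ij] := ltngtP i j; last by rewrite (val_inj ij) ltxx.
by apply/negbTE; rewrite -leNgt ltW // k_decr.
Qed.

Lemma k_inj : injective k.
Proof.
move=> i j kij; have [/k_decr|/k_decr|/val_inj//] := ltngtP i j.
  by rewrite kij ltxx.
by rewrite kij ltxx.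
Qed.

Lemma block_startE (b : 'I_p) :
  block_start ms b = #|[set s | k b < l s]%SET|.
Proof.
have lk s : exists b', k b' == l s.
  have : l s \in codom k by rewrite k_values codom_f.
  by move=> /codomP[b' ->]; exists b'.
have /choice[beta betaP] := lk.
rewrite /block_start -sum1dep_card (partition_big beta (fun b' : 'I_p => b' < b)%N) /=.
  apply: eq_bigr => b' b'b; rewrite ms_mult -sum1dep_card; apply: eq_bigl => s.
  rewrite -(eqP (betaP s)) (inj_eq k_inj) k_lt.
  by case: eqP => [->|_]; rewrite ?b'b ?andbF.
by move=> s; rewrite -k_lt (eqP (betaP s)).
Qed.

Lemma block_endE (b : 'I_p) :
  (block_start ms b + ms b)%N = #|[set s | k b <= l s]%SET|.
Proof.
rewrite block_startE ms_mult -cardsUI.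
rewrite [X in (_ + X)%N](_ : _ = 0%N) ?addn0; last first.
  apply: eq_card0 => t; rewrite !inE; apply/negbTE/negP => /andP[+ /eqP e].
  by rewrite e ltxx.
by apply: eq_card => t; rewrite !inE le_eqVlt orbC eq_sym.
Qed.

(** The indices with [k b <= l s] and those with [k b < l s] form two initial
    segments of the index set, and the block [b] is their difference. *)
Lemma in_block (b : 'I_p) (s : 'I_n.+1) :
  (l s == k b) = (block_start ms b <= s < block_start ms b + ms b)%N.
Proof.
have dn1 : forall i j : 'I_n.+1, (i <= j)%N ->
    j \in [set s | k b < l s]%SET -> i \in [set s | k b < l s]%SET.
  by move=> i j /l_noninc ij; rewrite !inE => /lt_le_trans; apply.
have dn2 : forall i j : 'I_n.+1, (i <= j)%N ->
    j \in [set s | k b <= l s]%SET -> i \in [set s | k b <= l s]%SET.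
  by move=> i j /l_noninc ij; rewrite !inE => /le_trans; apply.
have := downset_lt_card dn1 s; have := downset_lt_card dn2 s.
rewrite -block_endE -block_startE !inE => <- E1; rewrite leqNgt -E1.
by rewrite -leNgt eq_le.
Qed.

Lemma block_indexE (b : 'I_p) (j : 'I_(ms b)) :
  block_index n j = (block_start ms b + j)%N :> nat.
Proof.
rewrite /block_index inordK //.
apply: (@leq_trans (block_start ms b + ms b)%N); first by rewrite ltn_add2l.
by rewrite block_endE (leq_trans (max_card _)) // card_ord.
Qed.

Lemma l_block_index (b : 'I_p) (j : 'I_(ms b)) : l (block_index n j) = k b.
Proof.
by apply/eqP; rewrite in_block block_indexE leq_addr ltn_add2l ltn_ord.
Qed.

Lemma block_indexP (s : 'I_n.+1) (b : 'I_p) :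
  l s = k b -> exists j : 'I_(ms b), s = block_index n j.
Proof.
move=> /eqP; rewrite in_block => /andP[s1 s2].
have sj : (s - block_start ms b < ms b)%N by rewrite ltn_subLR.
by exists (Ordinal sj); apply/val_inj; rewrite /= block_indexE subnKC.
Qed.

Lemma block_index_ex (s : 'I_n.+1) :
  exists b : 'I_p, exists j : 'I_(ms b), s = block_index n j.
Proof.
have /codomP[b lb] : l s \in codom k by rewrite k_values codom_f.
by exists b; exact: block_indexP.
Qed.

Lemma block_index_eq (b : 'I_p) (i j : 'I_(ms b)) :
  (block_index n i == block_index n j) = (i == j).
Proof. by rewrite -val_eqE /= !block_indexE eqn_add2l. Qed.

(** ** Block-diagonal matrices *)

Definition block_emb (R : realType) (b : 'I_p) : 'M[R]_(n.+1, ms b) :=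
  \matrix_(s, j) (s == block_index n j)%:R.

(** The block-diagonal matrix with blocks [M b], as a sum of extensions by zero:
    products and transposes are then computed without any cast between the
    types ['M_(ms b)]. *)
Definition glue (R : realType) (M : forall b, 'M[R]_(ms b)) : 'M[R]_n.+1 :=
  \sum_b block_emb R b *m M b *m (block_emb R b)^T.

Lemma block_emb_orth (R : realType) (b b' : 'I_p) :
  b != b' -> (block_emb R b)^T *m block_emb R b' = 0.
Proof.
move=> bb'; apply/matrixP => i j; rewrite !mxE big1 // => s _; rewrite !mxE.
case: eqP => [->|]; last by rewrite mul0r.
case: eqP => [/(congr1 l)|]; last by rewrite mulr0.
by rewrite !l_block_index => /k_inj e; rewrite e eqxx in bb'.
Qed.

Lemma block_emb_norm (R : realType) (b : 'I_p) :
  (block_emb R b)^T *m block_emb R b = 1%:M.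
Proof.
apply/matrixP => i j; rewrite !mxE (bigD1 (block_index n i)) //= big1.
  by rewrite !mxE eqxx block_index_eq mul1r addr0.
by move=> s /negPf si; rewrite !mxE si mul0r.
Qed.

Lemma glue_mul (R : realType) (M K : forall b, 'M[R]_(ms b)) :
  glue M *m glue K = glue (fun b => M b *m K b).
Proof.
rewrite /glue mulmx_suml; apply: eq_bigr => b _.
rewrite mulmx_sumr (bigD1 b) //= big1 ?addr0.
  rewrite -!mulmxA; congr (_ *m (_ *m _)).
  by rewrite mulmxA block_emb_norm mul1mx.
move=> b' bb'; rewrite -!mulmxA [X in _ *m (_ *m X)]mulmxA.
by rewrite block_emb_orth 1?eq_sym // mul0mx !mulmx0.
Qed.

Lemma glue_tr (R : realType) (M : forall b, 'M[R]_(ms b)) :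
  (glue M)^T = glue (fun b => (M b)^T).
Proof.
rewrite /glue raddf_sum; apply: eq_bigr => b _ /=.
by rewrite !trmx_mul trmxK mulmxA.
Qed.

Lemma glue_in (R : realType) (M : forall b, 'M[R]_(ms b)) b i j :
  glue M (block_index n i) (block_index n j) = M b i j.
Proof.
have -> : M b = (block_emb R b)^T *m glue M *m block_emb R b.
  rewrite /glue mulmx_sumr mulmx_suml (bigD1 b) //= big1 ?addr0.
    rewrite -!mulmxA block_emb_norm mulmx1.
    by rewrite mulmxA block_emb_norm mul1mx.
  by move=> b' bb'; rewrite !mulmxA block_emb_orth 1?eq_sym // !mul0mx.
rewrite mxE (bigD1 (block_index n j)) //= [X in _ + X]big1 ?addr0; last first.
  by move=> s /negPf si; rewrite !mxE si mulr0.
rewrite [block_emb _ _ _ _]mxE eqxx mulr1.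
rewrite mxE (bigD1 (block_index n i)) //= [X in _ + X]big1 ?addr0; last first.
  by move=> s /negPf si; rewrite !mxE si mul0r.
by rewrite mxE [block_emb _ _ _ _]mxE eqxx mul1r.
Qed.

Lemma glue_off (R : realType) (M : forall b, 'M[R]_(ms b)) s t :
  l s != l t -> glue M s t = 0.
Proof.
move=> st; rewrite /glue summxE big1 // => b _.
rewrite mxE big1 // => j _; rewrite [(block_emb R b)^T _ _]mxE [block_emb _ _ _ _]mxE.
case: eqP => [tj|]; last by rewrite mulr0.
rewrite mulr1 mxE big1 // => i _; rewrite mxE.
case: eqP => [si|]; last by rewrite mul0r.
by rewrite si tj !l_block_index eqxx in st.
Qed.

Lemma glueP (R : realType) (M : forall b, 'M[R]_(ms b)) (K : 'M[R]_n.+1) :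
  (forall s t, l s != l t -> K s t = 0) ->
  (forall b, diag_block ms K b = M b) -> K = glue M.
Proof.
move=> K0 KM; apply/matrixP => s t.
have [st|/[dup] st /K0 ->] := eqVneq (l s) (l t); last by rewrite glue_off.
have [b [i si]] := block_index_ex s; rewrite {}si {s} l_block_index in st *.
have [j ->] := block_indexP (esym st).
by rewrite glue_in -KM mxE.
Qed.

End blocks.

(** * Eigenvalues of a pencil with scales constant on blocks *)

(** Here [S^-1 L S] tends to the block-diagonal part of [L]: the entry
    [L i j * s j / s i] is constant inside a block, tends to [0] below it because
    [s j] is then negligible with respect to [s i], and is [0] above it because
    [L] is lower triangular. *)
Lemma block_eigenvalues (T : Type) (F : set_system T) (FF : Filter F)
    (R : realType) (n : nat) (l : 'I_n.+1 -> int) (p : nat) (k : 'I_p -> int)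
    (ms : 'I_p -> nat)
    (blk : block_decomposition l k ms)
    (A B : T -> 'M[R]_n.+1) (G D L : 'M[R]_n.+1) (s mu : T -> 'I_n.+1 -> R)
    (V : forall b, 'M[R]_(ms b)) (lam : forall b, 'I_(ms b) -> R) :
  let Si e := diag_mx (\row_i (s e i)^-1) in
  (\forall e \near F, (A e)^T = A e) -> (\forall e \near F, (B e)^T = B e) ->
  (\forall e \near F, forall i, 0 < s e i) ->
  mconv F (fun e => Si e *m A e *m Si e) G ->
  mconv F B 1%:M ->
  (forall e i j, l i = l j -> s e i = s e j) ->
  (forall i j, l j < l i -> s e i / s e j @[e --> F] --> (0 : R)) ->
  gram_schmidt_pair G D L -> (forall i, 0 < D i i) ->
  (forall b, (V b)^T *m ((diag_block ms L b)^T *m diag_block ms L b) *m V b = 1%:M) ->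
  (forall b, (V b)^T *m diag_block ms D b *m V b = diag_mx (\row_j lam b j)) ->
  (forall b (i j : 'I_(ms b)), (i <= j)%N -> lam b i <= lam b j) ->
  (\forall e \near F, ordered_geigenvalues (A e) (B e) (mu e)) ->
  forall (b : 'I_p) (j : 'I_(ms b)) (eta : R), 0 < eta ->
  \forall e \near F,
    `|mu e (block_index n j) - lam b j * s e (block_index n j) ^+ 2|
      <= eta * s e (block_index n j) ^+ 2.
Proof.
have [l_noninc _ _ _] := blk.
move=> Si Asym Bsym spos hA hB sS sR [Ddiag Ltrig L1 DE] D0 VQ VD lamS hmu.
pose X := glue n V.
pose Lm := glue n (fun b => diag_block ms L b).
pose lamg i := glue n (fun b => diag_mx (\row_j lam b j)) i i.
have lamgE b j : lamg (block_index n j) = lam b j.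
  by rewrite /lamg (glue_in blk) !mxE eqxx mulr1n.
have glueX M K := glue_mul blk (R := R) M K.
have neq i j : l i != l j -> (i == j) = false by apply: contraNF => /eqP ->.
have QX : (Lm *m X)^T *m (Lm *m X) = 1%:M.
  rewrite trmx_mul !glue_tr !glueX; symmetry.
  apply: (glueP blk) => [i j /neq ij|b].
    by rewrite mxE ij.
  rewrite -!mulmxA [RHS](_ : _ = 1%:M); last by rewrite -(VQ b) !mulmxA.
  apply/matrixP => i j; rewrite !mxE.
  by rewrite (block_index_eq blk).
have DM : D = glue n (fun b => diag_block ms D b).
  apply: (glueP blk) => // i j /neq ij.
  by apply: (is_diag_mxP Ddiag); rewrite (ij : (val i == val j) = false).
have DX : X^T *m D *m X = diag_mx (\row_i lamg i).
  rewrite DM glue_tr !glueX.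
  apply/esym/(glueP blk) => [i j /neq ij|b].
    by rewrite !mxE ij.
  rewrite VD; apply/matrixP => i j; rewrite !mxE.
  by rewrite (block_index_eq blk) lamgE.
have GX : (L *m X)^T *m G *m (L *m X) = diag_mx (\row_i lamg i).
  by rewrite -DX DE trmx_mul !mulmxA.
have lam0 i : 0 < lamg i.
  have X0 : row i X^T != 0.
    apply/eqP => Xi; have := congr1 (row i) QX.
    rewrite trmx_mul -mulmxA row_mul Xi mul0mx => /rowP/(_ i).
    by rewrite !mxE eqxx => /esym/eqP; rewrite oner_eq0.
  have -> : lamg i = qf D (row i X^T).
    have /matrixP/(_ i i) := DX; rewrite [RHS]mxE eqxx mulr1n [RHS]mxE => <-.
    rewrite /qf -row_mul [LHS]mxE [RHS]mxE; apply: eq_bigr => q _.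
    by rewrite [(row _ _)^T _ _]mxE ![row _ _ _ _]mxE [X^T _ _]mxE.
  have -> : D = diag_mx (\row_i D i i).
    apply/matrixP => u v; rewrite !mxE.
    case: eqVneq => [->|uv]; first by rewrite mulr1n.
    by rewrite mulr0n; apply: (is_diag_mxP Ddiag).
  rewrite qf_diag lt_def sumr_ge0 ?andbT; last first.
    by move=> q _; rewrite mulr_ge0 ?sqr_ge0 // mxE ltW.
  apply: contra X0 => /eqP /psumr_eq0P zz; apply/eqP/rowP => q; rewrite mxE.
  have /eqP : (\row_i D i i) 0 q * (row i X^T) 0 q ^+ 2 = 0.
    by apply: zz => // t _; rewrite mulr_ge0 ?sqr_ge0 // mxE ltW.
  by rewrite mulf_eq0 mxE gt_eqF //= sqrf_eq0 mxE => /eqP ->; rewrite mxE.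
have hX e i j : X i j != 0 -> s e i = s e j.
  move=> Xij; apply: sS; apply/eqP; apply: contraNT Xij => lij.
  by rewrite /X (glue_off blk) // eqxx.
have hL : mconv F (fun e => Si e *m L *m diag_mx (\row_i s e i)) Lm.
  move=> i j.
  rewrite [X in X @ F --> _](_ : _ = fun e => L i j * (s e j / s e i)); last first.
    by apply/funext => e; rewrite mul_mx_diag mxE mul_diag_mx !mxE; ring.
  have [lij|lij] := eqVneq (l i) (l j).
    have -> : Lm i j = L i j.
      have [b [i' ii']] := block_index_ex blk i.
      have lb : l j = k b by rewrite -lij ii' (l_block_index blk).
      have [j' jj'] := block_indexP blk lb.
      by rewrite ii' jj' /Lm (glue_in blk) mxE.
    apply: cvg_near_cst; near=> e.
    have se : forall i, 0 < s e i by near: e.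
    by rewrite (sS e _ _ lij) divff ?mulr1 // gt_eqF.
  rewrite /Lm (glue_off blk) //.
  have [ij|ji] := ltnP i j.
    by rewrite (is_trig_mxP Ltrig) //; under eq_fun do rewrite mul0r; exact: cvg_cst.
  rewrite -[0](mulr0 (L i j)); apply: cvgMr; apply: sR.
  by rewrite lt_neqAle lij l_noninc.
(* Inside a block the scales agree and [lam b] is sorted; between two blocks the
   ratio of the scales eventually beats the ratio of the [lamg]. *)
have srt : \forall e \near F, forall i j : 'I_n.+1, (i <= j)%N ->
     lamg i * s e i ^+ 2 <= lamg j * s e j ^+ 2.
  apply: filter_forall => i; apply: filter_forall => j.
  have [ij|ij] := leqP i j; last by near=> e.
  have [lij|lij] := eqVneq (l i) (l j).
    near=> e => _; rewrite (sS e _ _ lij) ler_wpM2r ?sqr_ge0 //.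
    have [b [i' ii']] := block_index_ex blk i.
    have lb : l j = k b by rewrite -lij ii' (l_block_index blk).
    have [j' jj'] := block_indexP blk lb.
    move: ij; rewrite ii' jj' !lamgE => ij; apply: lamS; move: ij.
    by rewrite !(block_indexE blk) leq_add2l.
  have tol0 : 0 < Num.min 1 (lamg j / lamg i) by rewrite lt_min ltr01 divr_gt0.
  have lji : l j < l i by rewrite lt_neqAle eq_sym lij l_noninc.
  have /cvgr0Pnorm_le/(_ _ tol0) small := sR i j lji.
  near=> e => _.
  have se : forall i, 0 < s e i by near: e.
  have : `|s e i / s e j| <= Num.min 1 (lamg j / lamg i) by near: e; exact: small.
  have r0 : 0 < s e i / s e j by rewrite divr_gt0.
  rewrite gtr0_norm // le_min => /andP[r1 r2].
  have -> : s e i = (s e i / s e j) * s e j by rewrite divfK ?gt_eqF.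
  rewrite exprMn mulrA ler_wpM2r ?sqr_ge0 //.
  apply: (@le_trans _ _ (lamg i * (s e i / s e j))).
    by rewrite ler_pM2l // expr2 ler_piMl // ltW.
  by rewrite mulrC -ler_pdivlMr.
move=> b j eta eta0.
(* For [d <= 1/2], the bounds [(1 - d) / (1 + d)] and [(1 + d) / (1 - d)] differ
   from [1] by at most [4 * d]. *)
pose d := Num.min 2^-1 (eta / (4 * lam b j)).
have lbj : 0 < lam b j by rewrite -lamgE.
have d0 : 0 < d by rewrite lt_min invr_gt0 ltr0n divr_gt0 // mulr_gt0.
have d2 : d <= 2^-1 by rewrite ge_min lexx.
have d01 : 0 < d < 1 by rewrite d0 (le_lt_trans d2) // invf_lt1 ?ltr1n.
have main := graded_eigenvalues FF Asym Bsym spos hA hB hL hX GX QX lam0 srt hmu d01.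
near=> e.
have /(_ (block_index n j)) : forall j : 'I_n.+1,
    (1 - d) * (lamg j * s e j ^+ 2) <= (1 + d) * mu e j /\
    (1 - d) * mu e j <= (1 + d) * (lamg j * s e j ^+ 2) by near: e.
rewrite lamgE; set m := mu e _; set t := s e _ ^+ 2 => -[h1 h2].
have t0 : 0 <= t by exact: sqr_ge0.
have x0 : 0 <= lam b j * t by rewrite mulr_ge0 // ltW.
have key : 4 * d * (lam b j * t) <= eta * t.
  rewrite mulrA ler_wpM2r // -mulrA mulrCA -ler_pdivlMr ?mulr_gt0 //.
  by rewrite ge_min lexx orbT.
set x := lam b j * t in h1 h2 x0 key *.
rewrite ler_norml; apply/andP; split; nra.
Unshelve. all: by end_near. Qed.

(** * Adding a last row and column *)

Definition ext (R : realType) (n : nat) (M : 'M[R]_n) (x : R) : 'M[R]_n.+1 :=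
  \matrix_(i, j)
    match unlift ord_max i, unlift ord_max j with
    | Some i', Some j' => M i' j'
    | None, None => x
    | _, _ => 0
    end.

Lemma wid_lift (n : nat) (i : 'I_n) : wid i = lift ord_max i.
Proof. by apply/val_inj; rewrite /= /bump leqNgt ltn_ord. Qed.

Lemma unlift_wid (n : nat) (i : 'I_n) : unlift ord_max (wid i) = Some i.
Proof. by rewrite wid_lift liftK. Qed.

Lemma wid_neq_max (n : nat) (i : 'I_n) : (wid i == ord_max) = false.
Proof. by rewrite wid_lift eq_sym (negPf (neq_lift _ _)). Qed.

Lemma ord_max_or_wid (n : nat) (i : 'I_n.+1) :
  i = ord_max \/ exists i', i = wid i'.
Proof.
case: (unliftP ord_max i) => [i' ->|->]; last by left.
by right; exists i'; rewrite wid_lift.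
Qed.

Lemma ext_wid (R : realType) (n : nat) (M : 'M[R]_n) x i j :
  ext M x (wid i) (wid j) = M i j.
Proof. by rewrite mxE !unlift_wid. Qed.

Lemma ext_row (R : realType) (n : nat) (M : 'M[R]_n) x j :
  ext M x ord_max (wid j) = 0.
Proof. by rewrite mxE unlift_wid unlift_none. Qed.

Lemma ext_col (R : realType) (n : nat) (M : 'M[R]_n) x i :
  ext M x (wid i) ord_max = 0.
Proof. by rewrite mxE unlift_wid unlift_none. Qed.

Lemma ext_max (R : realType) (n : nat) (M : 'M[R]_n) x :
  ext M x ord_max ord_max = x.
Proof. by rewrite mxE unlift_none. Qed.

Definition extE := (ext_wid, ext_row, ext_col, ext_max).

Lemma ext_tr (R : realType) (n : nat) (M : 'M[R]_n) x : (ext M x)^T = ext M^T x.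
Proof.
apply/matrixP => i j; rewrite [LHS]mxE.
by have [->|[i' ->]] := ord_max_or_wid i; have [->|[j' ->]] := ord_max_or_wid j;
  rewrite !extE // mxE.
Qed.

Lemma ext_mul (R : realType) (n : nat) (M K : 'M[R]_n) x y :
  ext M x *m ext K y = ext (M *m K) (x * y).
Proof.
apply/matrixP => i j; rewrite [LHS]mxE big_ord_recr /=.
have [->|[i' ->]] := ord_max_or_wid i; have [->|[j' ->]] := ord_max_or_wid j;
  rewrite !extE ?mulr0 ?mul0r ?addr0 ?add0r.
- by rewrite big1 ?add0r // => q _; rewrite extE mul0r.
- by rewrite big1 // => q _; rewrite extE mul0r.
- by rewrite big1 // => q _; rewrite !extE mulr0.
- by rewrite mxE; apply: eq_bigr => q _; rewrite !ext_wid.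
Qed.

Lemma ext_gram_schmidt (R : realType) (n : nat) (A D L : 'M[R]_n) (c : R) :
  gram_schmidt_pair A D L ->
  gram_schmidt_pair (ext A c) (ext D c) (ext L 1).
Proof.
move=> [Dd Lt L1 DE]; split.
- apply/is_diag_mxP => i j.
  have [->|[i' ->]] := ord_max_or_wid i; have [->|[j' ->]] := ord_max_or_wid j;
    rewrite !extE // ?eqxx // => ij.
  exact: (is_diag_mxP Dd).
- apply/is_trig_mxP => i j.
  have [->|[i' ->]] := ord_max_or_wid i; have [->|[j' ->]] := ord_max_or_wid j;
    rewrite !extE // ?ltnn // => ij.
  exact: (is_trig_mxP Lt).
- by move=> i; have [->|[i' ->]] := ord_max_or_wid i; rewrite extE.
- by rewrite ext_tr !ext_mul mul1r mulr1 -DE.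
Qed.

(** [D i i] is the value of the form [A] at the [i]-th column of [L], which does
    not vanish since its [i]-th entry is [1]. *)
Lemma gram_schmidt_gt0 (R : realType) (n : nat) (A D L : 'M[R]_n) :
  posdef_mx A -> gram_schmidt_pair A D L -> forall i, 0 < D i i.
Proof.
move=> [_ Ap] [_ _ L1 ->] i.
have c0 : col i L != 0.
  by apply/eqP => /colP/(_ i); rewrite !mxE L1 => /eqP; rewrite oner_eq0.
have := Ap _ c0; congr (0 < _).
rewrite tr_col -row_mul [LHS]mxE [RHS]mxE; apply: eq_bigr => q _.
by rewrite [row _ _ _ _]mxE [col _ _ _ _]mxE.
Qed.

(** * The scales [eps ^ l_i] and [|log eps| ^ (-1/2)] *)

(** The form in which the asymptotic hypotheses on the entries of [A] give the
    convergence of the entries of [S^-1 A S^-1]. *)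
Lemma scaled_cvg (T : Type) (F : set_system T) (FF : Filter F) (R : realType)
    (f h w u v : T -> R) (g : R) :
  (forall eta, 0 < eta -> \forall e \near F, `|f e - h e| <= eta * `|w e|) ->
  (\forall e \near F, [/\ h e = g * w e, w e = u e * v e, 0 < u e & 0 < v e]) ->
  (u e)^-1 * f e * (v e)^-1 @[e --> F] --> g.
Proof.
move=> fo hw; apply/cvgrPdistC_le => eta eta0.
have fo_eta := fo _ eta0.
near=> e.
have [he we u0 v0] : [/\ h e = g * w e, w e = u e * v e, 0 < u e & 0 < v e] by near: e.
have :  `|f e - h e| <= eta * `|w e| by near: e.
rewrite he we => fe.
have -> : (u e)^-1 * f e * (v e)^-1 - g = (f e - g * (u e * v e)) / (u e * v e).
  by field; rewrite !gt_eqF.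
rewrite normrM normfV ler_pdivrMr ?normr_gt0 ?mulf_neq0 ?gt_eqF //.
Unshelve. all: by end_near. Qed.

Lemma expz_le (R : realType) (e : R) (x : int) :
  0 < e -> e <= 1 -> 0 < x -> e ^ x <= e.
Proof.
move=> e0 e1; case: x => [[//|a] _|//].
by rewrite -exprnP exprS ler_piMr ?(ltW e0) // exprn_ile1 // (ltW e0).
Qed.

Lemma near0_small (R : realType) (x : R) : 0 < x ->
  \forall e \near 0^'+, 0 < e < x.
Proof.
move=> x0; near=> e; apply/andP; split; near: e; first exact: nbhs_right_gt.
exact: nbhs_right_lt.
Unshelve. all: by end_near. Qed.

(** The bound on [e * |ln e|], that is on [ln x / x] at [x = 1 / e], shows that
    every positive integer power of [e] is negligible with respect to the
    logarithmic scale. *)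
Lemma abs_ln (R : realType) (e : R) : 0 < e < 1 -> 0 < `|ln e| /\ e * `|ln e| <= 1.
Proof.
move=> e01; have /andP[e0 e1] := e01.
have l0 : ln e < 0 by exact: ln_lt0.
split; first by rewrite normr_gt0 lt_eqF.
have -> : `|ln e| = ln e^-1 by rewrite ltr0_norm // lnV.
rewrite -[leRHS](divff (lt0r_neq0 e0)) ler_pM2l //.
by rewrite ltW // ln_sublinear // invr_gt0.
Qed.

Definition scale (R : realType) (n : nat) (l : 'I_n.+1 -> int) (e : R)
    (i : 'I_n.+1) : R :=
  if i == ord_max then (Num.sqrt `|ln e|)^-1 else e ^ l i.

Section scales.
Variables (R : realType) (n : nat) (l : 'I_n.+2 -> int).
Hypothesis l_noninc : forall s t : 'I_n.+2, (s <= t)%N -> l t <= l s.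
Hypothesis l_last : l ord_max = 0.
Hypothesis l_penult : 0 < l (wid ord_max).

Lemma l_wid_gt0 (i : 'I_n.+1) : 0 < l (wid i).
Proof. by apply: lt_le_trans l_penult _; apply: l_noninc; rewrite /= -ltnS. Qed.

Lemma l_eq0 (i : 'I_n.+2) : l i = 0 -> i = ord_max.
Proof.
have [->//|[i' ->] l0] := ord_max_or_wid i.
by have := l_wid_gt0 i'; rewrite l0 ltxx.
Qed.

Lemma scale_wid (e : R) (i : 'I_n.+1) : scale l e (wid i) = e ^ l (wid i).
Proof. by rewrite /scale wid_neq_max. Qed.

Lemma scale_max (e : R) : scale l e ord_max = (Num.sqrt `|ln e|)^-1.
Proof. by rewrite /scale eqxx. Qed.

Lemma scale_eq (e : R) (i j : 'I_n.+2) :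
  l i = l j -> scale l e i = scale l e j.
Proof.
have [->|[i' ->]] := ord_max_or_wid i; have [->|[j' ->]] := ord_max_or_wid j => // lij.
- by rewrite -(l_eq0 (i := wid j')) // -lij.
- by rewrite (l_eq0 (i := wid i')) // lij.
- by rewrite !scale_wid lij.
Qed.

Lemma scale_gt0 : \forall e \near (0 : R)^'+, forall i, 0 < scale l e i.
Proof.
near=> e => i.
have e01 : 0 < e < 1 by near: e; exact: near0_small.
have [->|[i' ->]] := ord_max_or_wid i; rewrite ?scale_max ?scale_wid.
  by rewrite invr_gt0 sqrtr_gt0; case: (abs_ln e01).
by rewrite exprz_gt0 //; case/andP: e01.
Unshelve. all: by end_near. Qed.

(** Between two powers the ratio is at most [e].  Against the logarithmic scale it
    is at most [e * sqrt |ln e| <= sqrt e]. *)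
Lemma scale_ratio (i j : 'I_n.+2) : l j < l i ->
  scale l e i / scale l e j @[e --> (0 : R)^'+] --> (0 : R).
Proof.
have [->|[i' ->]] := ord_max_or_wid i.
  have [->|[j' ->]] := ord_max_or_wid j; first by rewrite ltxx.
  by rewrite l_last ltNge ltW // l_wid_gt0.
move=> lji; apply/cvgr0Pnorm_le => eta eta0; near=> e.
have e01 : 0 < e < 1 by near: e; exact: near0_small.
have spos : forall i, 0 < scale l e i by near: e; exact: scale_gt0.
have /andP[e0 e1] := e01.
rewrite gtr0_norm ?divr_gt0 // scale_wid.
have [jE|[j' jE]] := ord_max_or_wid j; rewrite {}jE in lji *.
  rewrite scale_max invrK.
  apply: (@le_trans _ _ (e * Num.sqrt `|ln e|)).
    by rewrite ler_wpM2r ?sqrtr_ge0 // expz_le ?l_wid_gt0 // ltW.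
  have eE : e = Num.sqrt (e ^+ 2) by rewrite sqrtr_sqr gtr0_norm.
  rewrite [X in X * _]eE -sqrtrM ?sqr_ge0 //.
  have -> : eta = Num.sqrt (eta ^+ 2) by rewrite sqrtr_sqr gtr0_norm.
  rewrite ler_sqrt ?sqr_ge0 // expr2 -mulrA.
  apply: (@le_trans _ _ e); first by rewrite ler_piMr ?(ltW e0) //; case: (abs_ln e01).
  apply/ltW; suff /andP[] : 0 < e < eta ^+ 2 by [].
  by near: e; apply: near0_small; rewrite exprn_gt0.
rewrite scale_wid invr_expz -expfzDr ?gt_eqF //.
apply: (@le_trans _ _ e); first by rewrite expz_le ?subr_gt0 // ltW.
apply/ltW; suff /andP[] : 0 < e < eta by [].
by near: e; exact: near0_small.
Unshelve. all: by end_near. Qed.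

End scales.

(** * Proof of the asymptotics *)

(** A diagonal block of a unitriangular matrix is unitriangular, hence
    invertible. *)
Lemma diag_block_trig_inj (R : realType) (n : nat) (l : 'I_n.+1 -> int) (p : nat)
    (k : 'I_p -> int) (ms : 'I_p -> nat) (blk : block_decomposition l k ms)
    (L : 'M[R]_n.+1) (b : 'I_p) :
  is_trig_mx L -> (forall i, L i i = 1) ->
  forall z : 'rV_(ms b), z != 0 -> z *m (diag_block ms L b)^T != 0.
Proof.
move=> Lt L1; have Lu : (diag_block ms L b)^T \in unitmx.
  rewrite unitmx_tr unitmxE det_trig; last first.
    apply/is_trig_mxP => i j ij; rewrite mxE; apply: (is_trig_mxP Lt).
    by rewrite !(block_indexE blk) ltn_add2l.
  by rewrite big1 ?unitr1 // => i _; rewrite mxE.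
by move=> z; apply: contra => /eqP zL; rewrite -(mulmxK Lu z) zL mul0mx.
Qed.

Theorem proposition18 (R : realType) (n : nat)
    (A B : R -> 'M[R]_n.+2) (A0 : 'M[R]_n.+1)
    (l : 'I_n.+2 -> int) (c : R)
    (A_sym : \forall eps \near 0^'+, symmetric_mx (A eps))
    (B_sym : \forall eps \near 0^'+, symmetric_mx (B eps))
    (l_noninc : forall s t : 'I_n.+2, (s <= t)%N -> l t <= l s)
    (l_last : l ord_max = 0)
    (l_penult : 0 < l (wid ord_max))
    (A0_posdef : posdef_mx A0)
    (c_gt0 : 0 < c)
    (A_main : forall i j : 'I_n.+1,
       (fun eps : R => A eps (wid i) (wid j) : R)
       = (fun eps : R => A0 i j * eps ^ (l (wid i) + l (wid j)))
         +o_ (0^'+) (fun eps : R => eps ^ (l (wid i) + l (wid j))))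
    (A_row : forall j : 'I_n.+1,
       (fun eps : R => A eps ord_max (wid j) : R)
       =o_ (0^'+) (fun eps : R => eps ^ l (wid j) / Num.sqrt `|ln eps|))
    (A_col : forall j : 'I_n.+1,
       (fun eps : R => A eps (wid j) ord_max : R)
       =o_ (0^'+) (fun eps : R => eps ^ l (wid j) / Num.sqrt `|ln eps|))
    (A_last :
       (fun eps : R => A eps ord_max ord_max : R)
       = (fun eps : R => c / `|ln eps|) +o_ (0^'+) (fun eps : R => 1 / `|ln eps|))
    (B_main : forall i j : 'I_n.+2,
       (fun eps : R => B eps i j : R)
       = (fun _ : R => (i == j)%:R : R) +o_ (0^'+) (fun _ : R => 1 : R))
    (mu : R -> 'I_n.+2 -> R)
    (mu_eig : \forall eps \near 0^'+,
       ordered_geigenvalues (A eps) (B eps) (mu eps))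
    (p : nat) (k : 'I_p -> int) (ms : 'I_p -> nat)
    (k_decr : forall i j : 'I_p, (i < j)%N -> k j < k i)
    (k_values : codom k =i codom l)
    (ms_mult : forall i : 'I_p, ms i = #|[set s | l s == k i]%SET|)
    (D0 L0 : 'M[R]_n.+1)
    (DL_pair : gram_schmidt_pair A0 D0 L0)
    (mu0 : forall i : 'I_p, 'I_(ms i) -> R)
    (mu0_eig : forall i : 'I_p, (i.+1 < p)%N ->
       ordered_geigenvalues (diag_block ms D0 i)
         ((diag_block ms L0 i)^T *m diag_block ms L0 i) (mu0 i)) :
  (forall (i : 'I_p) (j : 'I_(ms i)), (i.+1 < p)%N ->
     (fun eps : R => mu eps (block_index n.+1 j))
     = (fun eps : R => mu0 i j * eps ^ (2 * k i))
       +o_ (0^'+) (fun eps : R => eps ^ (2 * k i)))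
  /\ (fun eps : R => mu eps ord_max)
     = (fun eps : R => c / `|ln eps|) +o_ (0^'+) (fun eps : R => 1 / `|ln eps|).
Proof.
have blk : block_decomposition l k ms by split.
have [DG LT L1 _] := DL_pair.
have GS := ext_gram_schmidt c DL_pair.
have D0pos := gram_schmidt_gt0 A0_posdef DL_pair.
(* The last block [b0] is the one where [l] vanishes; it only contains [ord_max]. *)
have [b0 kb0] : exists b0, k b0 = 0.
  have /codomP[b0 e] : 0 \in codom k by rewrite k_values -l_last codom_f.
  by exists b0.
have l_ge0 i : 0 <= l i by rewrite -l_last l_noninc // -ltnS.
have k_ge0 (b : 'I_p) : 0 <= k b.
  have /codomP[s ->] : k b \in codom l by rewrite -k_values codom_f.
  exact: l_ge0.
have b0_last : b0.+1 = p.
  apply/eqP; rewrite eqn_leq ltn_ord leqNgt; apply/negP => b0p.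
  have := k_decr b0 (Ordinal b0p) (ltnSn _).
  by rewrite kb0 ltNge k_ge0.
have k_gt0 (b : 'I_p) : (b.+1 < p)%N -> 0 < k b.
  by move=> bp; rewrite -kb0; apply: k_decr; rewrite -ltnS b0_last.
have k_last (b : 'I_p) : (b.+1 < p)%N = false -> b = b0.
  move=> bp; apply/val_inj/eqP; rewrite -eqSS b0_last eqn_leq ltn_ord /=.
  by rewrite leqNgt bp.
have inner (b : 'I_p) (j : 'I_(ms b)) : (b.+1 < p)%N ->
    block_index n.+1 j = wid (block_index n j).
  move=> bp; have vE := block_indexE blk j.
  have [jm|[j' jE]] := ord_max_or_wid (block_index n.+1 j).
    have := k_gt0 b bp; rewrite -(l_block_index blk j) jm l_last ltxx //.
  apply/val_inj; rewrite /= vE /block_index inordK // -vE jE /=.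
  exact: ltn_ord.
have outer (j : 'I_(ms b0)) : block_index n.+1 j = ord_max.
  by apply: (l_eq0 l_noninc l_penult); rewrite (l_block_index blk).
(* The eigenbasis of each block; on the last one, which is the 1-by-1 pencil
   [(c, 1)], it is the identity. *)
have blocks (b : 'I_p) : exists VL : 'M[R]_(ms b) * ('I_(ms b) -> R),
  [/\ VL.1^T *m ((diag_block ms (ext L0 1) b)^T *m diag_block ms (ext L0 1) b)
        *m VL.1 = 1%:M,
      VL.1^T *m diag_block ms (ext D0 c) b *m VL.1 = diag_mx (\row_j VL.2 j),
      forall i j : 'I_(ms b), (i <= j)%N -> VL.2 i <= VL.2 j &
      if (b.+1 < p)%N then VL.2 = mu0 b else VL.2 = fun=> c].
  have [bp|bp] := boolP (b.+1 < p)%N.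
    have bE (M : 'M[R]_n.+1) x : diag_block ms (ext M x) b = diag_block ms M b.
      by apply/matrixP => i j; rewrite !mxE !inner // !unlift_wid.
    rewrite !bE; have [muS _] := mu0_eig b bp.
    have Ds : (diag_block ms D0 b)^T = diag_block ms D0 b.
      apply/matrixP => i j; rewrite !mxE.
      have [->//|ij] := eqVneq (block_index n i) (block_index n j).
      by rewrite !(is_diag_mxP DG) // eq_sym.
    have Qs : ((diag_block ms L0 b)^T *m diag_block ms L0 b)^T
        = (diag_block ms L0 b)^T *m diag_block ms L0 b.
      by rewrite trmx_mul trmxK.
    have Qp : posqf ((diag_block ms L0 b)^T *m diag_block ms L0 b).
      have [_ LT' L1' _] := GS.
      move=> z z0; have := diag_block_trig_inj blk LT' L1' z0; rewrite bE.
      move=> /sum_sqr_gt0; rewrite -qf1 /qf mulmx1 trmx_mul trmxK.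
      by rewrite !mulmxA.
    have [V VQ VD] := geigenbasis Ds Qs Qp (mu0_eig b bp).
    by exists (V^T, mu0 b); split; rewrite /= ?trmxK.
  have bb0 : b = b0 by apply: k_last; exact: negbTE.
  rewrite {b bp}bb0; exists (1%:M, fun=> c) => /=.
  have ij (i j : 'I_(ms b0)) : i = j.
    by apply/eqP; rewrite -(block_index_eq blk) !outer.
  have -> : diag_block ms (ext L0 1) b0 = 1%:M.
    by apply/matrixP => i j; rewrite [LHS]mxE !outer ext_max mxE (ij i j) eqxx.
  have -> : diag_block ms (ext D0 c) b0 = c%:M.
    by apply/matrixP => i j; rewrite [LHS]mxE !outer ext_max mxE (ij i j) eqxx.
  rewrite trmx1 !mulmx1 mul1mx; split=> //.
    by apply/matrixP => i j; rewrite !mxE.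
pose V b := (sval (cid (blocks b))).1; pose lam b := (sval (cid (blocks b))).2.
have VLP b : [/\ (V b)^T *m ((diag_block ms (ext L0 1) b)^T *m
        diag_block ms (ext L0 1) b) *m V b = 1%:M,
      (V b)^T *m diag_block ms (ext D0 c) b *m V b = diag_mx (\row_j lam b j),
      forall i j : 'I_(ms b), (i <= j)%N -> lam b i <= lam b j &
      if (b.+1 < p)%N then lam b = mu0 b else lam b = fun=> c].
  exact: svalP (cid (blocks b)).
have VQ b := let: And4 h _ _ _ := VLP b in h.
have VD b := let: And4 _ h _ _ := VLP b in h.
have lamS b := let: And4 _ _ h _ := VLP b in h.
have Dext i : 0 < ext D0 c i i.
  by have [->|[i' ->]] := ord_max_or_wid i; rewrite extE.
have hB : mconv 0^'+ B 1%:M.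
  move=> i j; rewrite mxE; apply/cvgrPdistC_le => eta eta0.
  have /eqaddoP/(_ _ eta0) := B_main i j.
  by apply: filterS => e; rewrite normr1 mulr1.
have zero_o (f w : R -> R) : f =o_ (0^'+) w ->
    forall eta, 0 < eta ->
      \forall e \near 0^'+, `|f e - (fun=> 0) e| <= eta * `|w e|.
  move=> /eqoP fo eta eta0; have := fo _ eta0.
  by apply: filterS => e; rewrite subr0.
have hA : mconv 0^'+ (fun e => diag_mx (\row_i (scale l e i)^-1) *m A e *m
    diag_mx (\row_i (scale l e i)^-1)) (ext A0 c).
  move=> i j.
  rewrite [X in X @ _ --> _](_ : _ =
    fun e => (scale l e i)^-1 * A e i j * (scale l e j)^-1); last first.
    by apply/funext => e; rewrite mul_mx_diag mxE mul_diag_mx !mxE.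
  have [iE|[i' iE]] := ord_max_or_wid i; have [jE|[j' jE]] := ord_max_or_wid j;
    rewrite {}iE {}jE {i j} extE.
  - have /eqaddoP Ao := A_last; apply: (scaled_cvg _ Ao); near=> e.
    have spos : forall i, 0 < scale l e i by near: e; exact: scale_gt0.
    have e01 : 0 < e < 1 by near: e; exact: near0_small.
    have [ln0 _] := abs_ln e01.
    by split; rewrite ?div1r // scale_max -invfM -expr2 sqr_sqrtr //.
  - apply: (scaled_cvg _ (zero_o _ _ (A_row j'))); near=> e.
    have spos : forall i, 0 < scale l e i by near: e; exact: scale_gt0.
    by split; rewrite // ?mul0r // scale_max scale_wid mulrC.
  - apply: (scaled_cvg _ (zero_o _ _ (A_col i'))); near=> e.
    have spos : forall i, 0 < scale l e i by near: e; exact: scale_gt0.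
    by split; rewrite // ?mul0r // scale_max scale_wid.
  - have /eqaddoP Ao := A_main i' j'; apply: (scaled_cvg _ Ao); near=> e.
    have spos : forall i, 0 < scale l e i by near: e; exact: scale_gt0.
    have e01 : 0 < e < 1 by near: e; exact: near0_small.
    by split=> //; rewrite !scale_wid expfzDr // gt_eqF //; case/andP: e01.
have main := block_eigenvalues _ blk A_sym B_sym (scale_gt0 _ l) hA hB
  (fun e i j => scale_eq l_noninc l_last l_penult e (i := i) (j := j))
  (scale_ratio l_noninc l_last l_penult) GS Dext VQ VD lamS mu_eig.
split=> [b j bp|]; apply/eqaddoP => eta eta0.
  apply: (filterS _ (main _ b j eta eta0)) => e.
  have lamE : lam b j = mu0 b j by case: (VLP b) => _ _ _; rewrite bp => ->.
  have sE : scale l e (block_index n.+1 j) ^+ 2 = e ^ (2 * k b).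
    by rewrite inner // scale_wid -inner // (l_block_index blk) exprnP exprz_exp mulrC.
  rewrite lamE sE => mainE; rewrite (le_trans mainE) // ler_wpM2l ?ler_norm //.
  exact: ltW.
have [j0 j0E] : exists j0 : 'I_(ms b0), ord_max = block_index n.+1 j0.
  by apply: (block_indexP blk); rewrite kb0.
apply: (filterS _ (main _ b0 j0 eta eta0)) => e.
have lamE : lam b0 j0 = c by case: (VLP b0) => _ _ _; rewrite b0_last ltnn => ->.
have sE : scale l e ord_max ^+ 2 = 1 / `|ln e|.
  by rewrite scale_max div1r exprVn sqr_sqrtr.
rewrite lamE -j0E sE => mainE; rewrite (le_trans _ (le_trans mainE _)) //.
  by rewrite div1r.
by rewrite ler_wpM2l ?ler_norm // ltW.
Unshelve. all: by end_near. Qed.
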